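(* Let $\kappa$ be a weakly compact cardinal and $A$ be a subset of ${}^\kappa\kappa$. Then $A$ satisfies the Hurewicz dichotomy if and only if it satisfies the Miller-tree Hurewicz dichotomy.
   Context: Weakly compact cardinals are uncountable. ${}^\kappa\kappa$ is the set of all functions from $\kappa$ to $\kappa$ with the bounded topology, whose basic open sets are $N_s=\{x\in{}^\kappa\kappa \mid s\subseteq x\}$ for $s\in{}^{<\kappa}\kappa$ (functions from an ordinal ${<}\kappa$ into $\kappa$). $A\subseteq{}^\kappa\kappa$ is $\kappa$-compact if every open cover of $A$ has a subcover of size less than $\kappa$, and $\mathrm{K}_\kappa$ if it is a union of $\kappa$-many $\kappa$-compact subsets of ${}^\kappa\kappa$. A subtree of ${}^{<\kappa}\kappa$ is a subset closed under initial segments; $[T]=\{x\in{}^\kappa\kappa\mid \forall\alpha<\kappa\ (x\restriction\alpha\in T)\}$. A subtree $T$ is superclosed if it is closed under unions of increasing sequences of length ${<}\kappa$. A $\kappa$-Miller tree is a (nonempty) superclosed subtree $T$ such that every $t\in T$ is extended by some $s\in T$ which has at least $\kappa$-many immediate successors in $T$. $A\subseteq{}^\kappa\kappa$ satisfies the Hurewicz dichotomy if either $A$ is contained in a $\mathrm{K}_\kappa$ subset of ${}^\kappa\kappa$, or else $A$ contains a closed subset of ${}^\kappa\kappa$ homeomorphic to ${}^\kappa\kappa$. $A$ satisfies the Miller-tree Hurewicz dichotomy if either $A$ is contained in a $\mathrm{K}_\kappa$ subset of ${}^\kappa\kappa$, or else there is a $\kappa$-Miller tree $T$ with $[T]\subseteq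 A$. *)

(* Defs.v *)
From HB Require Import structures.
From mathcomp Require Import all_boot all_order.
From mathcomp Require Import boolp classical_sets functions cardinality topology.

Set Implicit Arguments.
Unset Strict Implicit.
Unset Printing Implicit Defensive.

Import Order.TTheory.

Local Open Scope classical_set_scope.
Local Open Scope card_scope.
Local Open Scope order_scope.

(** A cardinal kappa is represented by a totally ordered type [K] that is
    well-ordered and order-isomorphic to an initial ordinal.  An ordinal
    alpha < kappa is an element [a : K], identified with the set of its
    predecessors [[set b | b < a]]; the ordinal 0 is [\bot]. *)

Definition card_lt T U (A : set T) (B : set U) : Prop :=
  (A #<= B) /\ ~ (B #<= A).

Definition initial_ordinal d (K : bOrderType d) : Prop :=
  well_founded (fun a b : K => a < b) /\
  forall a : K, card_lt [set b | b < a] [set: K].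

(** kappa is uncountable and kappa --> (kappa)^2_2.  A colouring of the
    two-element subsets of kappa is a [c : K -> K -> bool] of which only the
    values [c a b] with [a < b] matter. *)
Definition weakly_compact d (K : bOrderType d) : Prop :=
  [/\ initial_ordinal K,
      ~ countable [set: K] &
      forall c : K -> K -> bool,
        exists (H : set K) (i : bool),
          ([set: K] #<= H) /\
          forall a b, H a -> H b -> a < b -> c a b = i].

(** ^{<kappa}kappa : partial functions whose domain is the set of predecessors
    of some [a : K]. *)
Record ltseq d (K : bOrderType d) := LtSeq {
  ltseq_val :> K -> option K;
  ltseq_dom : exists a : K, forall b, isSome (ltseq_val b) = (b < a) }.

Lemma ltseq0_subproof d (K : bOrderType d) :
  exists a : K, forall b : K, isSome (@None K) = (b < a).
Proof. by exists \bot => b; rewrite ltx0. Qed.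

Definition ltseq0 d (K : bOrderType d) : ltseq K := LtSeq (ltseq0_subproof K).

HB.instance Definition _ d (K : bOrderType d) := gen_eqMixin (ltseq K).
HB.instance Definition _ d (K : bOrderType d) := gen_choiceMixin (ltseq K).
HB.instance Definition _ d (K : bOrderType d) :=
  isPointed.Build (ltseq K) (ltseq0 K).

Definition ltseq_sub d (K : bOrderType d) (s t : ltseq K) : Prop :=
  forall b v, s b = Some v -> t b = Some v.

(** ^kappa kappa : a copy of [K -> K], so that the bounded topology does not
    compete with the library's topologies on function types. *)
Definition gbaire d (K : bOrderType d) : Type := K -> K.

HB.instance Definition _ d (K : bOrderType d) := Choice.on (gbaire K).

(** The basic open set N_s. *)
Definition cone d (K : bOrderType d) (s : ltseq K) : set (gbaire K) :=
  [set x | forall b v, s b = Some v -> x b = v].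

Lemma restr_subproof d (K : bOrderType d) (x : gbaire K) (a : K) :
  exists a' : K, forall b,
    isSome (if b < a then Some (x b) else None) = (b < a').
Proof. by exists a => b; case: (b < a). Qed.

Definition restr d (K : bOrderType d) (x : gbaire K) (a : K) : ltseq K :=
  LtSeq (restr_subproof x a).

Lemma cone_cover d (K : bOrderType d) :
  \bigcup_(s in [set: ltseq K]) cone s = [set: gbaire K].
Proof. by rewrite -subTset => x _; exists (ltseq0 K). Qed.

Lemma cone_join d (K : bOrderType d) (s t : ltseq K) (x : gbaire K) :
  [set: ltseq K] s -> [set: ltseq K] t -> cone s x -> cone t x ->
  exists r : ltseq K,
    [/\ [set: ltseq K] r, cone r x & cone r `<=` cone s `&` cone t].
Proof.
move=> _ _ sx tx.
have [a sa] := ltseq_dom s; have [a' ta] := ltseq_dom t.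
exists (restr x (Order.max a a')); split => //.
  by move=> b v /=; case: ifP => // _ [].
move=> y yr; have yx b : b < Order.max a a' -> y b = x b.
  by move=> ba; apply: yr => /=; rewrite ba.
split=> b v sbv.
- by rewrite yx ?(sx _ _ sbv)// lt_max -sa sbv.
- by rewrite yx ?(tx _ _ sbv)// lt_max -ta sbv orbT.
Qed.

HB.instance Definition _ d (K : bOrderType d) :=
  @isBaseTopological.Build (gbaire K) (ltseq K) [set: ltseq K]
    (@cone d K) (cone_cover K) (@cone_join d K).

Definition kappa_compact d (K : bOrderType d) (A : set (gbaire K)) : Prop :=
  forall U : set (set (gbaire K)),
    (forall O, U O -> open O) -> A `<=` \bigcup_(O in U) O ->
    exists V : set (set (gbaire K)),
      [/\ V `<=` U, A `<=` \bigcup_(O in V) O & card_lt V [set: K]].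

Definition K_kappa d (K : bOrderType d) (A : set (gbaire K)) : Prop :=
  exists C : K -> set (gbaire K),
    (forall i, kappa_compact (C i)) /\ A = \bigcup_(i in [set: K]) C i.

Definition subtree d (K : bOrderType d) (T : set (ltseq K)) : Prop :=
  forall s t, T t -> ltseq_sub s t -> T s.

Definition branches d (K : bOrderType d) (T : set (ltseq K)) :
    set (gbaire K) :=
  [set x | forall a, T (restr x a)].

(** Of [u : K -> ltseq K], only the terms [u i] with [i < a] belong to the
    sequence, which thus has length [a]; its union has to be in [T], hence in
    particular to be bounded. *)
Definition superclosed d (K : bOrderType d) (T : set (ltseq K)) : Prop :=
  forall (a : K) (u : K -> ltseq K),
    (forall i, i < a -> T (u i)) ->
    (forall i j, i <= j -> j < a -> ltseq_sub (u i) (u j)) ->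
    exists2 s, T s &
      forall b v, s b = Some v <-> exists2 i, i < a & u i b = Some v.

Definition immediate_successor d (K : bOrderType d) (s t : ltseq K) : Prop :=
  [/\ ltseq_sub s t, s <> t &
      forall r, ltseq_sub s r -> ltseq_sub r t -> r = s \/ r = t].

Definition miller_tree d (K : bOrderType d) (T : set (ltseq K)) : Prop :=
  [/\ T !=set0, subtree T, superclosed T &
      forall t, T t -> exists s,
        [/\ T s, ltseq_sub t s &
            [set: K] #<= [set r | T r /\ immediate_successor s r]]].

Definition homeomorphic_to_subset (X Y : topologicalType) (C : set Y) : Prop :=
  exists (f : X -> Y) (g : Y -> X),
    [/\ continuous f, range f = C, cancel f g & {within C, continuous g}].

Definition hurewicz_dichotomy d (K : bOrderType d) (A : set (gbaire K)) :
    Prop :=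
  (exists2 B, K_kappa B & A `<=` B) \/
  (exists C : set (gbaire K),
     [/\ closed C, homeomorphic_to_subset (gbaire K) C & C `<=` A]).

Definition miller_hurewicz_dichotomy d (K : bOrderType d)
    (A : set (gbaire K)) : Prop :=
  (exists2 B, K_kappa B & A `<=` B) \/
  (exists2 T, miller_tree T & branches T `<=` A).

(* Main.v *)
(** Call a scheme a family of nodes [W z a], depending on [z] below [a] only,
    such that [W z a] extends the [z b]-th of kappa-many chosen immediate
    successors of [W z b] for all [b < a]. The branches of a scheme form the set
    of branches of a Miller tree, and also a closed copy of ^kappa kappa. So it
    suffices to find schemes. In a Miller tree one recursively passes to splitting
    nodes and their successors. Given a homeomorphism [f] of ^kappa kappa onto a
    closed set, every [f[N_t]] has a kappa-splitting node: otherwise pick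
    [x_i] in [N_t] with [x_i(len t) = i]; by kappa --> (kappa)^2_2 the
    [f(x_i)] are lexicographically monotone on a set [H] of size kappa, hence
    converge along [H], and continuity of the inverse of [f] at the limit makes
    [i = x_i(len t)] eventually constant on [H]. Shrinking [N_t] into the preimages
    of the successors of this node and iterating gives the scheme. The
    K_kappa alternatives of both dichotomies coincide. *)

Require Import Defs.
From HB Require Import structures.
From mathcomp Require Import all_boot all_order.
From mathcomp Require Import boolp classical_sets functions cardinality topology.

Set Implicit Arguments.
Unset Strict Implicit.
Unset Printing Implicit Defensive.

Import Order.TTheory.

Local Open Scope classical_set_scope.
Local Open Scope card_scope.
Local Open Scope order_scope.

(** * Comparing cardinalities through injections *)

Lemma card_le_inj T U (A : set T) (B : set U) (f : T -> U) :
  (forall x, A x -> B (f x)) -> (forall x y, A x -> A y -> f x = f y -> x = y) ->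
  A #<= B.
Proof.
move=> fAB finj; have [g] : $|{injfun A >-> B}|.
  by apply/injfunPex; exists f => // x y; rewrite !inE; exact: finj.
exact: inj_card_le.
Qed.

Lemma card_leT_ex T U (B : set U) : [set: T] #<= B ->
  exists2 f : T -> U, forall x, B (f x) & injective f.
Proof.
move=> /card_leP/injfunPex[f _ finj].
pose i (x : T) : [set: T] := SigSub (mem_set I : x \in setT).
exists (fun x => val (f (i x))) => [x|x y /val_inj]; first exact: set_valP.
by move=> /finj; rewrite !inE => /(_ I I) /(congr1 val).
Qed.

(** * Induction, recursion and agreement of functions below an ordinal *)

Section Order.
Context (d : Order.disp_t) (K : bOrderType d).
Implicit Types (a b i j m : K).

Definition agree X a (f g : K -> X) := forall b, b < a -> f b = g b.

Lemma agree_le X a b (f g : K -> X) : a <= b -> agree b f g -> agree a f g.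
Proof. by move=> ab fg c ca; apply: fg; exact: lt_le_trans ab. Qed.

Lemma agree_sym X a (f g : K -> X) : agree a f g -> agree a g f.
Proof. by move=> fg c /fg. Qed.

Lemma agree_trans X a (f g h : K -> X) : agree a f g -> agree a g h -> agree a f h.
Proof. by move=> fg gh c ca; rewrite fg ?gh. Qed.

Section InitialOrdinal.
Hypothesis K_init : initial_ordinal K.

Lemma lt_ind (P : K -> Prop) :
  (forall a, (forall b, b < a -> P b) -> P a) -> forall a, P a.
Proof. by case: K_init => wf _ H; apply: (well_founded_ind wf). Qed.

Lemma ex_least (P : K -> Prop) : (exists a, P a) ->
  exists2 m, P m & forall b, P b -> m <= b.
Proof.
move=> [a Pa]; apply: contrapT => Nm.
suff : forall a, ~ P a by move/(_ a).
elim/lt_ind => {Pa a} a IH Pa; apply: Nm; exists a => // b Pb.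
by rewrite leNgt; apply/negP => /IH /(_ Pb).
Qed.

(** [G] receives a total function, but by hypothesis it reads only the values below [a]; the values
    that are not yet defined are padded with [x0]. *)
Lemma transfinite_rec (X : Type) (x0 : X) (G : K -> (K -> X) -> X) :
  (forall a f g, agree a f g -> G a f = G a g) ->
  exists f : K -> X, forall a, f a = G a f.
Proof.
move=> Gext; case: K_init => wf _.
pose F a (rec : forall b, b < a -> X) := G a (fun b =>
  match pselect (b < a) with left ba => rec b ba | right _ => x0 end).
exists (Fix wf _ F) => a; rewrite Fix_eq => [|b f g fg].
  by apply: Gext => b ba; case: pselect.
by congr F; apply/functional_extensionality_dep => c;
  apply/functional_extensionality_dep.
Qed.

End InitialOrdinal.

(** * Weakly compact cardinals are limits and regular *)

Section WeaklyCompact.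
Hypothesis K_wc : weakly_compact K.

Let K_init : initial_ordinal K. Proof. by case: K_wc. Qed.

Lemma initial_segment_small a : ~ ([set: K] #<= [set b | b < a]).
Proof. by case: K_init => _ /(_ a)[]. Qed.

Lemma no_max a : exists b, a < b.
Proof.
apply: contrapT => amax; apply: (@initial_segment_small a).
have le_a b : b <= a by rewrite leNgt; apply/negP => ab; apply: amax; exists b.
have /infiniteP/card_leT_ex[g _ g_inj] : infinite_set [set: K].
  by case: K_wc => _ + _ => /[swap] /finite_set_countable.
(* Hilbert's hotel: [h] shifts the sequence [g] by one and so frees the value [g 0], to which [k]
   then redirects whatever hits the supposed maximum [a]. *)
pose h x := if pselect (exists n, g n = x) is left e then g (projT1 (cid e)).+1
            else x.
have h_inj : injective h.
  move=> x y; rewrite /h; case: pselect => [p|Nx]; case: pselect => [q|Ny].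
  - by case: cid => /= n <-; case: cid => /= m <- /g_inj[->].
  - by move=> e; case: Ny; eexists; exact: e.
  - by move=> e; case: Nx; eexists; exact/esym/e.
  - by [].
have hN0 x : h x <> g 0%N.
  rewrite /h; case: pselect => [p /g_inj //|Nx e].
  by apply: Nx; exists 0%N.
pose k x := if h x == a then g 0%N else h x.
apply: (@card_le_inj _ _ _ _ k) => [x _|x y _ _] /=; rewrite /k.
  rewrite lt_neqAle le_a andbT.
  by case: (altP (h x =P a)) => // <-; apply/eqP => /esym/hN0.
case: (altP (h x =P a)) => [xa|_]; case: (altP (h y =P a)) => [ya|_].
- by move=> _; apply: h_inj; rewrite xa ya.
- by move/esym/hN0.
- by move/hN0.
- exact: h_inj.
Qed.

Lemma ex_succ a : exists a', forall b, (b < a') = (b <= a).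
Proof.
have [a' aa' a'P] := ex_least K_init (no_max a).
exists a' => b; apply/idP/idP => [ba'|ba]; last exact: le_lt_trans aa'.
by rewrite leNgt; apply/negP => /a'P; rewrite leNgt ba'.
Qed.

Definition succ a := projT1 (cid (ex_succ a)).

Lemma lt_succ a b : (b < succ a) = (b <= a).
Proof. by rewrite /succ; case: cid. Qed.

Lemma ltS a : a < succ a. Proof. by rewrite lt_succ. Qed.

Lemma le_succ a b : (succ a <= b) = (a < b).
Proof. by rewrite leNgt lt_succ ltNge. Qed.

(** Regularity of kappa, from the partition property. If [h] is unbounded on [a], choose [P m < a]
    with [m < h (P m)] and colour pairs by whether [P] agrees on them. On a homogeneous set, [P] is
    either constant, which bounds the set by a value of [h], or injective into the predecessors of
    [a]. *)
Lemma regular a (h : K -> K) : exists m, forall i, i < a -> h i <= m.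
Proof.
apply: contrapT => Nm.
have /choice[P hP] m : exists i, i < a /\ m < h i.
  apply: contrapT => Ni; apply: Nm; exists m => i ia.
  by rewrite leNgt; apply/negP => mi; apply: Ni; exists i.
case: K_wc => _ _ /(_ (fun b c => P b == P c))[H [[] [KH Hc]]].
- have [[b Hb]|H0] := pselect (exists b, H b); last first.
    apply: (@initial_segment_small a); apply: card_le_trans KH _.
    by apply: subset_card_le => b Hb; case: H0; exists b.
  apply: (@initial_segment_small (h (P b))); apply: card_le_trans KH _.
  apply: subset_card_le => c Hc'; suff -> : P b = P c by case: (hP c).
  by case: (ltgtP b c) => [/Hc bc|/Hc cb|->//]; apply/eqP;
    [apply: bc | rewrite eq_sym; apply: cb].
- apply: (@initial_segment_small a); apply: card_le_trans KH _.
  apply: (@card_le_inj _ _ _ _ P) => [b _|b c Hb Hc' /eqP e].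
    by case: (hP b).
  case: (ltgtP b c) => // [/Hc|/Hc].
  + by rewrite e => /(_ Hb Hc').
  + by rewrite eq_sym e => /(_ Hc' Hb).
Qed.

Lemma large_unbounded (H : set K) : [set: K] #<= H ->
  forall a, exists2 h, H h & a <= h.
Proof.
move=> KH a; apply: contrapT => NH; apply: (@initial_segment_small a).
apply: card_le_trans KH (subset_card_le _) => h Hh /=.
by rewrite ltNge; apply/negP => ah; apply: NH; exists h.
Qed.

(** By regularity an increasing enumeration of elements of [H] never gets stuck before kappa. *)
Lemma unbounded_large (H : set K) : (forall a, exists2 h, H h & a < h) ->
  [set: K] #<= H.
Proof.
move=> Hub.
pose G a (f : K -> K) := xget \bot [set h | H h /\ forall b, b < a -> f b < h].
have [a f g fg|f fE] := transfinite_rec K_init \bot (G := G).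
  congr xget; apply/seteqP; split=> h [Hh hP]; split=> // b ba.
    by rewrite -fg ?hP.
  by rewrite fg ?hP.
have fP a : H (f a) /\ forall b, b < a -> f b < f a.
  rewrite fE.
  apply: (@xgetPex _ \bot [set h | H h /\ forall b, b < a -> f b < h]).
  have [m mP] := regular a f; have [h Hh mh] := Hub m.
  by exists h; split=> // b /mP /le_lt_trans; apply.
apply: (@card_le_inj _ _ _ _ f) => [a _|a b _ _ e]; first by case: (fP a).
case: (ltgtP a b) => // [/(proj2 (fP b))|/(proj2 (fP a))]; by rewrite e ltxx.
Qed.

End WeaklyCompact.
End Order.

(** * Nodes, cones, and the bounded topology in terms of agreement *)

Section Sequences.
Context (d : Order.disp_t) (K : bOrderType d).
Implicit Types (a b i j : K) (s t r : ltseq K) (x y : K -> K).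

Lemma ltseq_ext s t : s =1 t -> s = t.
Proof.
case: s t => [s sP] [t tP] /= st.
have {}st : s = t by exact/functional_extensionality_dep.
by subst t; congr LtSeq; exact: Prop_irrelevance.
Qed.

Lemma sub_refl s : ltseq_sub s s. Proof. by []. Qed.

Lemma sub_trans s t r : ltseq_sub s t -> ltseq_sub t r -> ltseq_sub s r.
Proof. by move=> st tr b v /st /tr. Qed.

Lemma sub_anti s t : ltseq_sub s t -> ltseq_sub t s -> s = t.
Proof.
move=> st ts; apply: ltseq_ext => b.
case sb: (s b) => [v|]; first exact/esym/st.
by case tb: (t b) => [v|//]; rewrite -sb (ts _ _ tb).
Qed.

Definition len s : K := projT1 (cid (ltseq_dom s)).

Lemma lenP s b : isSome (s b) = (b < len s).
Proof. by rewrite /len; case: cid. Qed.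

Lemma len_restr x a : len (restr x a) = a.
Proof.
apply/eqP; rewrite eq_le !leNgt -lenP /= ltxx /=; apply/negP => la.
by have := lenP (restr x a) (len (restr x a)); rewrite /= la ltxx.
Qed.

Lemma coneE s x b : cone s x -> b < len s -> s b = Some (x b).
Proof. by move=> sx; rewrite -lenP; case sb: (s b) => [v|//]; rewrite (sx _ _ sb). Qed.

Lemma cone_restrP a x y : cone (restr x a) y <-> agree a x y.
Proof.
split=> [xy b ba|xy b v /=]; last by case: ifP => // /xy -> [].
by apply/esym/xy; rewrite /= ba.
Qed.

Lemma cone_agree s a x y : len s <= a -> agree a x y -> cone s x -> cone s y.
Proof.
move=> sa xy sx b v sb; rewrite -(sx _ _ sb); apply/esym/xy.
by apply: lt_le_trans sa; rewrite -lenP sb.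
Qed.

Lemma cone_sub s t x : ltseq_sub s t -> cone t x -> cone s x.
Proof. by move=> st tx b v /st /tx. Qed.

Lemma cone_ex s : exists x, cone s x.
Proof. by exists (fun b => odflt \bot (s b)) => b v /= ->. Qed.

Lemma sub_len s t x : cone s x -> cone t x -> len s <= len t -> ltseq_sub s t.
Proof.
move=> sx tx st b v sb; rewrite -(sx _ _ sb); apply: coneE => //.
by apply: lt_le_trans st; rewrite -lenP sb.
Qed.

Lemma len_sub s t : ltseq_sub s t -> len s <= len t.
Proof.
rewrite leNgt => st; apply/negP; rewrite -lenP.
by case sb: (s _) => [v|//]; have := lenP t (len t); rewrite (st _ _ sb) ltxx.
Qed.

Lemma sub_restr s x a : cone s x -> len s <= a -> ltseq_sub s (restr x a).
Proof.
by move=> sx sa; apply: (@sub_len _ _ x); rewrite ?len_restr//; exact/cone_restrP.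
Qed.

Lemma restr_sub s x a : cone s x -> a <= len s -> ltseq_sub (restr x a) s.
Proof.
by move=> sx sa; apply: (@sub_len _ _ x); rewrite ?len_restr//; exact/cone_restrP.
Qed.

Lemma cone_comparable s t x : cone s x -> cone t x ->
  ltseq_sub s t \/ ltseq_sub t s.
Proof.
by move=> sx tx; have [st|/ltW st] := leP (len s) (len t); [left|right];
  exact: (@sub_len _ _ x).
Qed.

Lemma eq_len s t x : cone s x -> cone t x -> len s = len t -> s = t.
Proof. by move=> sx tx st; apply: sub_anti; apply: (@sub_len _ _ x); rewrite ?st. Qed.

Lemma sub_proper_len s t : ltseq_sub s t -> s <> t -> len s < len t.
Proof.
move=> st nst; rewrite lt_neqAle len_sub// andbT; apply/eqP => e; apply: nst.
by have [x tx] := cone_ex t; apply: eq_len e => //; exact: cone_sub tx.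
Qed.

(** The nodes through [x] form a chain in which [r] comes directly after [s], so a node not below
    [s] is already past [r]. *)
Lemma immediate_successor_min s r t x : immediate_successor s r ->
  cone r x -> cone t x -> ~ ltseq_sub t s -> ltseq_sub r t.
Proof.
move=> [sr nsr rP] rx tx nts.
have [//|tr] := cone_comparable rx tx.
have [st|//] := cone_comparable (cone_sub sr rx) tx.
by have [e|->//] := rP _ st tr; case: nts; rewrite e.
Qed.

Lemma immediate_successor_disjoint s r r' x :
  immediate_successor s r -> immediate_successor s r' ->
  cone r x -> cone r' x -> r = r'.
Proof.
move=> sr sr' rx r'x; apply: sub_anti.
- apply: immediate_successor_min sr rx r'x _ => r's.
  by case: sr' => sr' + _; apply; exact: sub_anti.
- apply: immediate_successor_min sr' r'x rx _ => rs.
  by case: sr => sr + _; apply; exact: sub_anti.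
Qed.

Lemma chain_cone (s : K -> ltseq K) :
  (forall a b, a <= b -> ltseq_sub (s a) (s b)) -> exists x, forall a, cone (s a) x.
Proof.
move=> s_mono.
exists (fun b => xget \bot [set v | exists a, s a b = Some v]) => a b v sv.
apply: xget_unique; first by exists a.
move=> w [a' sw]; have [/s_mono/(_ _ _ sv)|/ltW/s_mono/(_ _ _ sw)] := leP a a'.
  by rewrite sw => -[].
by rewrite sv => -[].
Qed.

(** The cones of the restrictions of [x] are a neighbourhood base at [x]: for a cone of [s] around
    [x], agreement below [len s] is enough. *)
Lemma nbhs_gbaireP (x : gbaire K) (A : set (gbaire K)) :
  nbhs x A <-> exists a, forall y, agree a x y -> A y.
Proof.
split.
- rewrite nbhsE => -[O [[D' _ <-] [s D's sx]] OA].
  exists (len s) => y xy; apply: OA; exists s => //.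
  exact: cone_agree xy sx.
- move=> [a aA]; rewrite nbhsE; exists (cone (restr x a)).
    split; last exact/cone_restrP.
    by exists [set restr x a]; [|rewrite bigcup_set1].
  by move=> y /cone_restrP/aA.
Qed.

Lemma closure_gbaireP (C : set (gbaire K)) (x : gbaire K) :
  closure C x <-> forall a, exists2 y, C y & agree a x y.
Proof.
split=> [Cx a|Cx A /nbhs_gbaireP[a aA]].
  have /Cx[y [Cy xy]] : nbhs x [set y | agree a x y].
    by apply/nbhs_gbaireP; exists a.
  by exists y.
by have [y Cy /aA Ay] := Cx a; exists y.
Qed.

Lemma continuous_gbaireP (f : gbaire K -> gbaire K) :
  continuous f <-> forall x a, exists b, forall y, agree b x y -> agree a (f x) (f y).
Proof.
split=> [fc x a|fc x A /nbhs_gbaireP[a aA]].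
  have /fc/nbhs_gbaireP : nbhs (f x) [set y | agree a (f x) y] by
    apply/nbhs_gbaireP; exists a.
  by [].
have [b bP] := fc x a.
by apply/nbhs_gbaireP; exists b => y /bP /aA.
Qed.

Lemma within_continuous_gbaireP (C : set (gbaire K)) (g : gbaire K -> gbaire K) :
  {within C, continuous g} <-> forall x a, C x -> exists b, forall y, C y ->
    agree b x y -> agree a (g x) (g y).
Proof.
rewrite subspace_continuousP.
split=> [gc x a Cx|gc x Cx A /nbhs_gbaireP[a aA]].
  have /(gc x Cx)/nbhs_gbaireP[b bP] : nbhs (g x) [set y | agree a (g x) y] by
    apply/nbhs_gbaireP; exists a.
  by exists b => y Cy /bP /(_ Cy).
have [b bP] := gc x a Cx.
by apply/nbhs_gbaireP; exists b => y /bP yP /yP /aA.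
Qed.

End Sequences.

(** * Miller schemes, their trees and their branches *)

Section Scheme.
Context (d : Order.disp_t) (K : bOrderType d).
Hypothesis K_wc : weakly_compact K.
Implicit Types (a b i j : K) (s t r : ltseq K) (x y z w : K -> K).

Let K_init : initial_ordinal K. Proof. by case: K_wc. Qed.

(** Regularity bounds the lengths of fewer than kappa nodes. Their least upper bound [l] is the
    exact length of the union, since any [b < l] lies below one of these lengths. *)
Lemma ltseq_union a (u : K -> ltseq K) :
  (forall i j, i <= j -> j < a -> ltseq_sub (u i) (u j)) ->
  exists s : ltseq K, forall b v, s b = Some v <-> exists2 i, i < a & u i b = Some v.
Proof.
move=> u_mono.
have u_eq i j b (v v' : K) :
    i < a -> j < a -> u i b = Some v -> u j b = Some v' -> v = v'.
  move=> ia ja ui uj; have [ij|/ltW ji] := leP i j.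
    by move: uj; rewrite (u_mono _ _ ij ja _ _ ui) => -[].
  by move: ui; rewrite (u_mono _ _ ji ia _ _ uj) => -[].
pose y b := xget \bot [set v | exists2 i, i < a & u i b = Some v].
have uy i : i < a -> cone (u i) y.
  move=> ia b v uv; apply: xget_unique => [|w [j ja uw]]; first by exists i.
  exact: u_eq ja ia uw uv.
have [m mP] := regular K_wc a (fun i => len (u i)).
have [l lP l_min] : exists2 l, (forall i, i < a -> len (u i) <= l) &
    forall b, (forall i, i < a -> len (u i) <= b) -> l <= b.
  by apply: (ex_least K_init (P := fun l => forall i, i < a -> len (u i) <= l)); exists m.
exists (restr y l) => b v /=; split=> [|[i ia ub]].
  case: ifP => // bl [<-]; apply: contrapT => Nb.
  suff : l <= b by rewrite leNgt bl.
  apply: l_min => i ia; rewrite leNgt; apply/negP => bi; apply: Nb; exists i => //.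
  exact: coneE (uy _ ia) bi.
rewrite -(uy _ ia _ _ ub) ifT//; apply: lt_le_trans (lP _ ia).
by rewrite -lenP ub.
Qed.

Lemma superclosed_setT : superclosed [set: ltseq K].
Proof. by move=> a u _ /ltseq_union[s sP]; exists s. Qed.

(* Limit steps need no separate treatment: [Phi z a] is any element of [T] that
   extends all the [step (Phi z b) (z b)] with [b < a]. *)
Lemma superclosed_rec (T : set (ltseq K)) (step : ltseq K -> K -> ltseq K) :
  superclosed T ->
  (forall t i, T t -> T (step t i) /\ ltseq_sub t (step t i)) ->
  exists Phi : (K -> K) -> K -> ltseq K,
    [/\ forall z a, T (Phi z a),
        forall z w a, agree a z w -> Phi z a = Phi w a &
        forall z a b, b < a -> ltseq_sub (step (Phi z b) (z b)) (Phi z a)].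
Proof.
move=> T_closed stepP.
pose ext z a (f : K -> ltseq K) :=
  [set s | T s /\ forall b, b < a -> ltseq_sub (step (f b) (z b)) s].
have ext_agree z w a f g : agree a z w -> agree a f g -> ext z a f = ext w a g.
  move=> zw fg; apply/seteqP; split=> s [Ts sP]; split=> // b ba.
    by rewrite -fg// -zw//; exact: sP.
  by rewrite fg// zw//; exact: sP.
have /choice[Phi PhiE] z : exists f, forall a, f a = xget (ltseq0 K) (ext z a f).
  apply: (transfinite_rec K_init (ltseq0 K)
    (G := fun a f => xget (ltseq0 K) (ext z a f))) => a f g fg.
  by congr xget; exact: ext_agree.
have PhiP z a : ext z a (Phi z) (Phi z a).
  elim/(lt_ind K_init): a => a IH; rewrite PhiE; apply: xgetPex.
  have stepT b : b < a -> T (step (Phi z b) (z b)).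
    by move=> /IH[Tb _]; case: (stepP _ (z b) Tb).
  case: (T_closed a (fun b => step (Phi z b) (z b))) => //.
    move=> i j; rewrite le_eqVlt => /predU1P[-> _|ij /IH[Tj jP]]; first exact: sub_refl.
    by apply: sub_trans (jP _ ij) _; case: (stepP _ (z j) Tj).
  by move=> s Ts sP; exists s; split=> // b ba c v bc; apply/sP; exists b.
exists Phi; split=> [z a|z w a|z a b]; try by case: (PhiP z a) => // _; apply.
elim/(lt_ind K_init): a => a IH zw; rewrite !PhiE; congr xget.
apply: ext_agree => // b ba; apply: IH => //; exact: agree_le (ltW ba) zw.
Qed.

(** A Miller tree without mention of limit nodes: [W z a] is the splitting node
    reached after following the choices [z b], [b < a], and [E z a i] is its
    [i]-th immediate successor. *)
Record miller_scheme (W : (K -> K) -> K -> ltseq K)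
    (E : (K -> K) -> K -> K -> ltseq K) : Prop := MillerScheme {
  scheme_node_agree : forall z w a, agree a z w -> W z a = W w a;
  scheme_succ_agree : forall z w a, agree a z w -> E z a = E w a;
  scheme_succP : forall z a i, immediate_successor (W z a) (E z a i);
  scheme_succ_inj : forall z a, injective (E z a);
  scheme_succ_sub : forall z a b, b < a -> ltseq_sub (E z b (z b)) (W z a) }.

Variables (W : (K -> K) -> K -> ltseq K) (E : (K -> K) -> K -> K -> ltseq K).
Hypothesis WE : miller_scheme W E.

Let W_agree := scheme_node_agree WE.
Let E_agree := scheme_succ_agree WE.
Let E_succ := scheme_succP WE.
Let E_inj := scheme_succ_inj WE.
Let E_sub := scheme_succ_sub WE.

Let W_lt z a b : b < a -> len (W z b) < len (W z a).
Proof.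
move=> /(@E_sub z _ _)/len_sub; apply: lt_le_trans.
by case: (E_succ z b (z b)) => WE0 WEn _; exact: sub_proper_len.
Qed.

Let W_mono z a b : b <= a -> ltseq_sub (W z b) (W z a).
Proof.
rewrite le_eqVlt => /predU1P[->//|/(@E_sub z _ _)]; apply: sub_trans.
by case: (E_succ z b (z b)).
Qed.

(** A strictly increasing function on ordinals dominates the identity; hence the nodes [W z a]
    determine the branch entirely. *)
Let le_len z a : a <= len (W z a).
Proof.
elim/(lt_ind K_init): a => a IH; rewrite leNgt; apply/negP => la.
by have := IH _ la; rewrite leNgt W_lt.
Qed.

Lemma scheme_branch_ex z : exists x : K -> K, forall a, cone (W z a) x.
Proof. by apply: chain_cone => a b; exact: W_mono. Qed.

Definition scheme_branch (z : gbaire K) : gbaire K := projT1 (cid (scheme_branch_ex z)).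
Local Notation F := scheme_branch.

Lemma cone_scheme_branch z a : cone (W z a) (F z).
Proof. by rewrite /F; case: cid. Qed.

Arguments cone_scheme_branch : clear implicits.

Lemma scheme_branch_unique z x : (forall a, cone (W z a) x) -> F z = x.
Proof.
move=> xP; apply/functional_extensionality_dep => b.
have /lt_le_trans/(_ (le_len z (succ K_wc b))) bl := ltS K_wc b.
by have := coneE (xP _) bl; rewrite (coneE (cone_scheme_branch _ _) bl) => -[].
Qed.

Lemma cone_scheme_succ z a : cone (E z a (z a)) (F z).
Proof. exact: cone_sub (E_sub (ltS K_wc a)) (cone_scheme_branch _ _). Qed.

Arguments cone_scheme_succ : clear implicits.

(** At a first difference [b < a], [F w] would pass through two distinct immediate successors of
    [W z b]. This gives injectivity of [F] and the continuity of its inverse. *)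
Lemma scheme_branch_agree z w a : cone (W z a) (F w) -> agree a z w.
Proof.
move=> Fw; elim/(lt_ind K_init) => b IH ba.
have zw : agree b z w by move=> c cb; apply: IH => //; exact: lt_trans ba.
apply: (E_inj (z := z) (a := b)).
apply: (immediate_successor_disjoint (E_succ _ _ _) (E_succ _ _ _)).
  exact: cone_sub (E_sub ba) Fw.
by rewrite (E_agree zw); exact: cone_scheme_succ.
Qed.

Lemma scheme_branch_inj : injective F.
Proof.
move=> z w zw; apply/functional_extensionality_dep => b.
apply: (@scheme_branch_agree _ _ (succ K_wc b)); last exact: ltS.
by rewrite -zw; exact: cone_scheme_branch.
Qed.

Definition scheme_tree : set (ltseq K) := [set s | exists z a, ltseq_sub s (W z a)].
Local Notation T := scheme_tree.

Lemma scheme_tree_succ z a i : T (E z a i).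
Proof.
(* Changing [z] at [a] alone does not affect [W z a] or its list of successors. *)
pose w b := if b == a then i else z b.
have zw : agree a w z by move=> b ba; rewrite /w lt_eqF.
exists w, (succ K_wc a); rewrite -(E_agree zw).
have := @E_sub w _ _ (ltS K_wc a); by rewrite {2}/w eqxx.
Qed.

(* If the first alternative fails, [z] is found by recursion: a node of [T] that
   properly extends all the [E z b (z b)] for [b < a], without being below
   [W z a], passes through some immediate successor of [W z a]. *)
Lemma scheme_tree_follow (y : K -> K) (I : set K) :
  (forall a b, I a -> b < a -> I b) ->
  (forall b, I b -> T (restr y (succ K_wc b))) ->
  (exists z a, forall b, I b -> W z a b = Some (y b)) \/
  (exists z, forall a b v, E z a (z a) b = Some v -> I b /\ y b = v).
Proof.
move=> Idown IT; have [|N] := pselect (exists z a, forall b, I b -> W z a b = Some (y b)).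
  by left.
right; pose below s := forall b v, s b = Some v -> I b /\ y b = v.
have [a f g fg|z zE] := transfinite_rec K_init \bot
    (G := fun a f => xget \bot [set i | below (E f a i)]).
  by congr xget; rewrite (E_agree fg).
exists z; elim/(lt_ind K_init) => a IH.
suff [i Ei] : exists i, below (E z a i).
  by rewrite zE; exact: (@xgetI _ _ [set i | below (E z a i)] i).
have [b Ib Wb] : exists2 b, I b & W z a b <> Some (y b).
  apply: contrapT => Nb; apply: N; exists z, a => b Ib.
  by apply: contrapT => Wb; apply: Nb; exists b.
set r := restr y (succ K_wc b).
have rb : r b = Some (y b) by rewrite /r /= ltS.
have r_below : below r.
  move=> c v; rewrite /r /= lt_succ; case: ifP => // cb [<-]; split=> //.
  by move: cb; rewrite le_eqVlt => /predU1P[->//|]; exact: Idown.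
have ry : cone r y by move=> c v /r_below[].
have rNW c : c <= a -> ~ ltseq_sub r (W z c).
  by move=> ca /(_ _ _ rb) /(W_mono ca).
(* The node [r] lies on the path of some [w]. This [w] agrees with [z] below [a], as a first
   disagreement would lead [y] through two immediate successors of one node. Then [r] extends
   [E w a (w a)], so [w a] is the choice sought. *)
have [w [a' rw]] := IT _ Ib; have [x wx] := cone_ex (W w a').
have rx := cone_sub rw wx.
have W_step c : c <= a -> c < a' -> agree c z w -> ltseq_sub (E w c (w c)) r.
  move=> ca ca' zw.
  apply: (immediate_successor_min (E_succ _ _ _) _ rx).
    exact: cone_sub (E_sub ca') wx.
  by rewrite -(W_agree zw); exact: rNW.
have a'N c : c <= a -> agree c z w -> c < a'.
  move=> ca zw; rewrite ltNge; apply/negP => a'c.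
  apply: (rNW a'); first exact: le_trans ca.
  by rewrite (W_agree (agree_le a'c zw)).
have zw : agree a z w.
  elim/(lt_ind K_init) => c IHc ca.
  have zw : agree c z w by move=> e ec; apply: IHc => //; exact: lt_trans ca.
  have /sub_trans wr := W_step _ (ltW ca) (a'N _ (ltW ca) zw) zw.
  apply: (E_inj (z := z) (a := c)).
  apply: (immediate_successor_disjoint (x := y) (E_succ _ _ _) (E_succ _ _ _)).
    by move=> e v /(IH _ ca) [].
  rewrite (E_agree zw); apply: cone_sub ry.
  exact: W_step (ltW ca) (a'N _ (ltW ca) zw) zw.
exists (w a) => c v; rewrite (E_agree zw).
by move=> /(W_step _ (lexx a) (a'N _ (lexx a) zw) zw) /r_below.
Qed.

Lemma scheme_tree_branches : branches T = range F.
Proof.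
apply/seteqP; split=> [y yT|_ [z _ <-] a]; last first.
  exists z, a; apply: restr_sub (le_len z a); exact: cone_scheme_branch.
have [//|//|[z [a Wy]]|[z zP]] := @scheme_tree_follow y setT.
  by have := lenP (W z a) (len (W z a)); rewrite Wy// ltxx.
exists z => //; apply: scheme_branch_unique => a b v.
case: (E_succ z a (z a)) => WE0 _ _.
by move=> /WE0 /zP[].
Qed.

(** The union [s] of the chain has all its proper initial segments in [T]. Following it either
    reaches a [W z c] above [s], or yields a [z] whose nodes all stay within [s], which is absurd as
    their lengths exceed [len s]. *)
Lemma scheme_tree_superclosed : superclosed T.
Proof.
move=> a u uT u_mono; have [s sP] := ltseq_union u_mono; exists s => //.
have [y sy] := cone_ex s.
have [b c /=|b /= bs|[z [c Wy]]|[z zP]] := @scheme_tree_follow y [set b | b < len s].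
- by move=> bs cb; exact: lt_trans bs.
- have /sP[i ia ub] := coneE sy bs; have [z [c uW]] := uT _ ia.
  exists z, c; apply: sub_trans uW; apply: restr_sub.
    by apply: cone_sub sy => e v ue; apply/sP; exists i.
  by rewrite le_succ -lenP ub.
- by exists z, c => b v sb; rewrite Wy ?(sy _ _ sb)//= -lenP sb.
- have := lt_le_trans (ltS K_wc (len s)) (le_len z (succ K_wc (len s))).
  rewrite -lenP; case Ws: (W _ _ _) => [v|//] _.
  case: (E_succ z (succ K_wc (len s)) (z (succ K_wc (len s)))) => /(_ _ _ Ws) Es _ _.
  by have /= [] := zP _ _ _ Es; rewrite ltxx.
Qed.

Lemma scheme_tree_miller : miller_tree T.
Proof.
split.
- by exists (W (fun=> \bot) \bot), (fun=> \bot), \bot.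
- by move=> s t [z [a tW]] st; exists z, a; exact: sub_trans tW.
- exact: scheme_tree_superclosed.
- move=> t [z [a tW]]; exists (W z a); split=> //; first by exists z, a.
  apply: (@card_le_inj _ _ _ _ (E z a)) => [i _|i j _ _ /E_inj//].
  by split; [exact: scheme_tree_succ | exact: E_succ].
Qed.

Lemma closed_branches (S : set (ltseq K)) : closed (branches S).
Proof.
move=> y /closure_gbaireP yS a; have [x xS yx] := yS a.
suff <- : restr x a = restr y a by exact: xS.
by apply: (@eq_len _ _ _ _ x); rewrite ?len_restr//; apply/cone_restrP.
Qed.

(** Continuity holds since [W z a] depends on [z] below [a] only and has length at least [a]; for
    the inverse, [len (W z a)] is a modulus. *)
Lemma scheme_branch_homeo : homeomorphic_to_subset (gbaire K) (range F).
Proof.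
pose G y := xget (y : gbaire K) [set z | F z = y].
have FK : cancel F G.
  by move=> z; apply: xget_unique => // w; exact: scheme_branch_inj.
exists F, G; split=> //.
- apply/continuous_gbaireP => z a; exists a => w zw.
  apply/cone_restrP; apply: cone_sub (cone_scheme_branch w a).
  rewrite -(W_agree zw); apply: restr_sub (le_len z a).
  exact: cone_scheme_branch.
- apply/within_continuous_gbaireP => _ a [z _ <-].
  exists (len (W z a)) => _ [w _ <-] zw; rewrite !FK.
  apply: scheme_branch_agree; apply: cone_agree zw _ => //.
  exact: cone_scheme_branch.
Qed.

End Scheme.

(** * Schemes from Miller trees and from closed copies *)

Section Dichotomies.
Context (d : Order.disp_t) (K : bOrderType d).
Hypothesis K_wc : weakly_compact K.
Implicit Types (a b i j : K) (s t r : ltseq K).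

Let K_init : initial_ordinal K. Proof. by case: K_wc. Qed.

(** For each node, [p] chooses a splitting node above it and kappa-many of its successors;
    superclosedness carries the iteration through limits. *)
Lemma miller_tree_scheme (T : set (ltseq K)) : miller_tree T ->
  exists W E, miller_scheme W E /\ forall z a, T (W z a).
Proof.
move=> [_ _ T_closed T_split].
have /choice[p pP] t : exists p : ltseq K * (K -> ltseq K), T t ->
    [/\ T p.1, ltseq_sub t p.1, injective p.2 &
        forall i, T (p.2 i) /\ immediate_successor p.1 (p.2 i)].
  have [/T_split[s [Ts ts /card_leT_ex[e eP e_inj]]]|nTt] := pselect (T t).
    by exists (s, e).
  by exists (t, fun=> t).
have [Phi [PhiT Phi_agree Phi_sub]] : exists Phi : (K -> K) -> K -> ltseq K,
    [/\ forall z a, T (Phi z a),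
        forall z w a, agree a z w -> Phi z a = Phi w a &
        forall z a b, b < a -> ltseq_sub ((p (Phi z b)).2 (z b)) (Phi z a)].
  apply: (superclosed_rec K_wc T_closed (step := fun t => (p t).2)) => t i Tt.
  have [_ tp _ /(_ i)[Tpi [pp _ _]]] := pP _ Tt.
  by split=> //; exact: sub_trans tp pp.
exists (fun z a => (p (Phi z a)).1), (fun z a => (p (Phi z a)).2).
split; last by move=> z a; case: (pP _ (PhiT z a)).
split=> [z w a zw|z w a zw|z a i|z a|z a b ba].
- by rewrite (Phi_agree _ _ _ zw).
- by rewrite (Phi_agree _ _ _ zw).
- by have [_ _ _ /(_ i)[]] := pP _ (PhiT z a).
- by case: (pP _ (PhiT z a)).
- apply: sub_trans (Phi_sub _ _ _ ba) _.
  by case: (pP _ (PhiT z a)).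
Qed.

Lemma miller_tree_closed_copy (T : set (ltseq K)) : miller_tree T ->
  exists C : set (gbaire K),
    [/\ closed C, homeomorphic_to_subset (gbaire K) C & C `<=` branches T].
Proof.
move=> T_miller; have [_ T_sub _ _] := T_miller.
have [W [E [WE WT]]] := miller_tree_scheme T_miller.
exists (range (scheme_branch WE)); split.
- by rewrite -(scheme_tree_branches K_wc WE); exact: closed_branches.
- exact: scheme_branch_homeo.
- rewrite -(scheme_tree_branches K_wc WE) => y yT a.
  by have [z [b /T_sub]] := yT a; apply.
Qed.

(* Ramsey argument: colour pairs by the lexicographic order. A homogeneous
   sequence is monotone, so its values at [b], once its values below [b] have
   stabilised, are monotone too; if they are bounded they stabilise. *)
Lemma lex_convergence (Y : K -> K -> K) :
  (forall b y, ~ ([set: K] #<= [set Y i b | i in [set i | agree b (Y i) y]])) ->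
  exists (H : set K) (y : K -> K), [set: K] #<= H /\
    forall b, exists a, forall h, H h -> a <= h -> agree b (Y h) y.
Proof.
move=> Ysmall; have [_ _ ramsey] := K_wc.
pose lex i j := exists2 b, agree b (Y i) (Y j) & Y i b < Y j b.
have [H [c [KH Hc]]] := ramsey (fun i j => `[< lex i j >]).
suff /choice[v /choice[th thP]] : forall b, exists v, exists a, forall h, H h ->
    a <= h -> Y h b = v.
  exists H, v; split=> // b; have [m mP] := regular K_wc b th.
  exists m => h Hh mh e eb; apply: thP => //; exact: le_trans (mP _ eb) mh.
elim/(lt_ind K_init) => b IH.
have /choice[y yP] e : exists v, e < b -> exists a, forall h, H h -> a <= h -> Y h e = v.
  have [/IH[v vP]|nb] := pselect (e < b); first by exists v.
  by exists \bot.
have /choice[th thP] e : exists a, e < b -> forall h, H h -> a <= h -> Y h e = y e.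
  have [/yP[a aP]|nb] := pselect (e < b); first by exists a.
  by exists \bot.
have [m mP] := regular K_wc b th.
have Yy h : H h -> m <= h -> agree b (Y h) y.
  by move=> Hh mh e eb; apply: thP => //; exact: le_trans (mP _ eb) mh.
have YY h h' : H h -> H h' -> m <= h -> m <= h' -> agree b (Y h) (Y h').
  by move=> Hh Hh' mh mh'; apply: agree_trans (Yy _ Hh mh) (agree_sym (Yy _ Hh' mh')).
have [h0 Hh0 mh0] := large_unbounded K_wc KH m.
case: c Hc => Hc.
- have Y_mono h h' : H h -> H h' -> m <= h -> h <= h' -> Y h b <= Y h' b.
    move=> Hh Hh' mh; rewrite le_eqVlt => /predU1P[->//|hh'].
    have /asboolP[e ee Ye] := Hc _ _ Hh Hh' hh'.
    have agr := YY _ _ Hh Hh' mh (le_trans mh (ltW hh')).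
    case: (ltgtP e b) => [eb|be|<-]; last exact: ltW.
      by move: Ye; rewrite agr// ltxx.
    by rewrite ee.
  (* These values are bounded: otherwise they would be kappa-many, against [Ysmall]. *)
  pose V := [set Y h b | h in [set h | H h /\ m <= h]].
  have [M VM] : exists M, forall v, V v -> v <= M.
    apply: contrapT => NM; apply: (Ysmall b y).
    suff : [set: K] #<= V.
      move=> /card_le_trans; apply; apply: subset_card_le.
      by move=> _ [h [Hh mh] <-]; exists h => //; exact: Yy.
    apply: (unbounded_large K_wc) => a; apply: contrapT => Na; apply: NM.
    by exists a => v Vv; rewrite leNgt; apply/negP => av; apply: Na; exists v.
  (* [tau] picks an index for each value in [V]. All values are at most [M], so by regularity one
     [n] bounds these indices; past [n] every value has occurred before, and monotonicity makes it
     constant. *)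
  have /choice[tau tauP] w : exists h, V w -> [/\ H h, m <= h & Y h b = w].
    have [[h [Hh mh] <-]|nV] := pselect (V w); first by exists h.
    by exists \bot.
  have [n nP] := regular K_wc (succ K_wc M) tau.
  have [h1 Hh1] := large_unbounded K_wc KH (Order.max m n).
  rewrite ge_max => /andP[mh1 nh1].
  exists (Y h1 b), h1 => h Hh h1h; apply/le_anti/andP; split; last exact: Y_mono.
  have Vh : V (Y h b) by exists h => //; split=> //; exact: le_trans h1h.
  have [Ht mt <-] := tauP _ Vh; apply: Y_mono => //.
  by apply: le_trans nh1; apply: nP; rewrite lt_succ; exact: VM.
(* The other colour: [lex] fails on pairs from [H], so the values at [b] do not increase, and the
   least of them is final once attained. *)
- have Y_mono h h' : H h -> H h' -> m <= h -> h <= h' -> Y h' b <= Y h b.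
    move=> Hh Hh' mh; rewrite le_eqVlt => /predU1P[->//|hh'].
    rewrite leNgt; apply/negP => lt_b.
    suff : lex h h' by move=> /asboolP; rewrite Hc.
    by exists b => //; apply: YY => //; exact: le_trans (ltW hh').
  have [v [h1 [Hh1 mh1 <-]] v_min] := ex_least K_init
    (P := fun v => exists h, [/\ H h, m <= h & Y h b = v])
    (ex_intro _ _ (ex_intro _ h0 (And3 Hh0 mh0 erefl))).
  exists (Y h1 b), h1 => h Hh h1h; apply/le_anti; rewrite Y_mono//=.
  by apply: v_min; exists h; split=> //; exact: le_trans h1h.
Qed.

(** The splitting node is [restr y b], its successors being told apart by the values [f x b]. *)
Lemma homeo_splitting (C : set (gbaire K)) (f g : gbaire K -> gbaire K) t :
  closed C -> range f = C -> cancel f g -> {within C, continuous g} ->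
  exists b y, [set: K] #<= [set f x b | x in [set x | cone t x /\ agree b (f x) y]].
Proof.
move=> C_closed fC fK /within_continuous_gbaireP gc; apply: contrapT => Nsplit.
(* The default [i] fills everything outside the domain of [t], in particular the place [len t]. *)
pose x i : K -> K := fun b => odflt i (t b).
have tx i : cone t (x i) by move=> b v; rewrite /x => ->.
have xl i : x i (len t) = i.
  by rewrite /x; have := lenP t (len t); rewrite ltxx; case: (t _).
have Cf z : C (f z) by rewrite -fC; exists z.
have [b y|H [y [KH yP]]] := @lex_convergence (fun i => f (x i)).
  move=> Kb; apply: Nsplit; exists b, y; apply: card_le_trans Kb _.
  by apply: subset_card_le => _ [i xy <-]; exists (x i).
have Cy : C y.
  apply: C_closed; apply/closure_gbaireP => b; have [a aP] := yP b.
  have [h Hh ah] := large_unbounded K_wc KH a.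
  by exists (f (x h)) => //; apply/agree_sym/aP.
have [b bP] := gc y (succ K_wc (len t)) Cy; have [a aP] := yP b.
(* Continuity of [g] at the limit [y] recovers the index [h] from [y] alone, although [H] is
   unbounded. *)
have xE h : H h -> a <= h -> h = g y (len t).
  move=> Hh ah; have := bP _ (Cf (x h)) (agree_sym (aP _ Hh ah)) _ (ltS K_wc _).
  by rewrite fK xl.
have [h Hh ah] := large_unbounded K_wc KH a.
have [h' Hh' hh'] := large_unbounded K_wc KH (succ K_wc h).
have := lt_le_trans (ltS K_wc h) hh'.
rewrite [X in X < _]xE// [X in _ < X]xE ?ltxx//.
by apply: le_trans ah (le_trans _ hh'); exact/ltW/ltS.
Qed.

Lemma homeo_scheme (C : set (gbaire K)) :
  closed C -> homeomorphic_to_subset (gbaire K) C ->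
  exists W E, exists WE : miller_scheme W E, range (scheme_branch WE) `<=` C.
Proof.
move=> C_closed [f [g [fc fC fK gc]]].
(* [p t] consists of a splitting node on the image side, its chosen successors, and for each
   successor a node above [t] whose cone [f] maps into that successor's cone. *)
have /choice[p pP] t : exists p : ltseq K * ((K -> ltseq K) * (K -> ltseq K)),
    [/\ injective p.2.1, forall i, immediate_successor p.1 (p.2.1 i),
        forall i, ltseq_sub t (p.2.2 i) &
        forall i x, cone (p.2.2 i) x -> cone (p.2.1 i) (f x)].
  have [b [y /card_leT_ex[e eP e_inj]]] := homeo_splitting t C_closed fC fK gc.
  have /choice[X XP] i : exists x, [/\ cone t x, agree b (f x) y & f x b = e i].
    by have [x [tx xy] <-] := eP i; exists x.
  have /choice[l lP] i : exists a, forall x, agree a (X i) x ->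
      agree (succ K_wc b) (f (X i)) (f x).
    by move/continuous_gbaireP: fc; apply.
  exists (restr y b, (fun i => restr (f (X i)) (succ K_wc b),
                      fun i => restr (X i) (Order.max (len t) (l i)))).
  split=> /= [i j ij|i|i|i x].
  - apply: e_inj; have [_ _ <-] := XP i; have [_ _ <-] := XP j.
    have : restr (f (X i)) (succ K_wc b) b = restr (f (X j)) (succ K_wc b) b.
      by rewrite ij.
    by rewrite /= ltS => -[].
  - have [_ xy _] := XP i.
    have yx : cone (restr y b) (f (X i)) by apply/cone_restrP/agree_sym.
    have xx : cone (restr (f (X i)) (succ K_wc b)) (f (X i)) by exact/cone_restrP.
    split.
    + by apply: sub_restr => //; rewrite len_restr ltW// ltS.
    + move=> /(congr1 (@len _ _)); rewrite !len_restr => bb.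
      by have := ltS K_wc b; rewrite -bb ltxx.
    + move=> r yr rx; have rfx := cone_sub rx xx.
      have := len_sub yr; rewrite len_restr le_eqVlt => /predU1P[br|br].
        by left; apply: (eq_len rfx yx); rewrite len_restr.
      right; apply: (eq_len rfx xx); apply/le_anti.
      by rewrite len_sub//= len_restr le_succ.
  - by have [tx _ _] := XP i; apply: sub_restr => //; rewrite le_max lexx.
  - move=> /cone_restrP Xx; apply/cone_restrP/lP; apply: agree_le Xx.
    by rewrite le_max lexx orbT.
have [Phi [_ Phi_agree Phi_sub]] : exists Phi : (K -> K) -> K -> ltseq K,
    [/\ forall z a, [set: ltseq K] (Phi z a),
        forall z w a, agree a z w -> Phi z a = Phi w a &
        forall z a b, b < a -> ltseq_sub ((p (Phi z b)).2.2 (z b)) (Phi z a)].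
  apply: (superclosed_rec K_wc (superclosed_setT K_wc) (step := fun t => (p t).2.2)).
  by move=> t i _; split=> //; have [_ _] := pP t.
have WE : miller_scheme (fun z a => (p (Phi z a)).1) (fun z a => (p (Phi z a)).2.1).
  split=> [z w a zw|z w a zw|z a i|z a|z a b ba].
  - by rewrite (Phi_agree _ _ _ zw).
  - by rewrite (Phi_agree _ _ _ zw).
  - by have [] := pP (Phi z a).
  - by case: (pP (Phi z a)).
  (* The recursion orders only the nodes [Phi] of the domain; the order of the image nodes has to be
     derived. All [f (x i)] pass through both [r] and [s]. If [s] did not extend [r], then [r] would
     extend every chosen successor of [s], though two distinct ones are incompatible. *)
  - have [e_inj eP te fe] := pP (Phi z a).
    have [_ _ _ fe'] := pP (Phi z b).
    set r := (p (Phi z b)).2.1 (z b); set s := (p (Phi z a)).1.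
    have /choice[x xP] i := cone_ex ((p (Phi z a)).2.2 i).
    have xr i : cone r (f (x i)).
      apply: fe'; apply: cone_sub (Phi_sub _ _ _ ba) _.
      exact: cone_sub (te i) (xP i).
    have xs i : cone s (f (x i)).
      by have [+ _ _] := eP i; move=> /cone_sub; apply; apply: fe.
    have [//|sr] := cone_comparable (xr \bot) (xs \bot).
    apply: contrapT => nrs.
    have er i : ltseq_sub ((p (Phi z a)).2.1 i) r.
      exact: immediate_successor_min (eP i) (fe _ _ (xP i)) (xr i) nrs.
    have [i i0] := no_max K_wc (\bot : K).
    suff : i = \bot by move=> e; move: i0; rewrite e ltxx.
    apply: e_inj; apply: (immediate_successor_disjoint (eP _) (eP _)).
      exact: cone_sub (er i) (xr \bot).
    exact: cone_sub (er _) (xr \bot).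
exists _, _, WE => _ [z _ <-].
(* A point [x] through all the [Phi z a] has [f x] as the branch of the scheme along [z], so this
   branch is in the range of [f]. *)
have [x xP] : exists x, forall a, cone (Phi z a) x.
  apply: chain_cone => a b; rewrite le_eqVlt => /predU1P[->//|/(Phi_sub z)].
  by apply: sub_trans; have [_ _] := pP (Phi z a).
rewrite (@scheme_branch_unique _ _ K_wc _ _ WE z (f x)); first by rewrite -fC; exists x.
move=> a; have [_ /(_ (z a))[Ws _ _] _ fe] := pP (Phi z a).
by apply: cone_sub Ws (fe _ _ _); exact: cone_sub (Phi_sub _ _ _ (ltS K_wc a)) (xP _).
Qed.

Lemma closed_copy_miller_tree (C : set (gbaire K)) :
  closed C -> homeomorphic_to_subset (gbaire K) C ->
  exists2 T, miller_tree T & branches T `<=` C.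
Proof.
move=> C_closed /(homeo_scheme C_closed)[W [E [WE FC]]].
exists (scheme_tree W); first exact: (scheme_tree_miller K_wc WE).
by rewrite (scheme_tree_branches K_wc WE).
Qed.

End Dichotomies.

Theorem theorem2p12 (d : Order.disp_t) (K : bOrderType d)
  (hK : weakly_compact K) (A : set (gbaire K)) :
  hurewicz_dichotomy A <-> miller_hurewicz_dichotomy A.
Proof.
split=> -[KA|]; [by left| |by left|].
- move=> [C [C_closed C_homeo CA]]; right.
  have [T T_miller TC] := closed_copy_miller_tree hK C_closed C_homeo.
  by exists T => //; exact: subset_trans CA.
- move=> [T T_miller TA]; right.
  have [C [C_closed C_homeo CT]] := miller_tree_closed_copy hK T_miller.
  by exists C; split=> //; exact: subset_trans TA.
Qed.
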